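(* Let $n$ be a non-negative integer, let $a,x$ be non-zero complex numbers, and let $\lambda\in\mathbb{C}$ satisfy $\lambda\ne 0$ and $(\lambda;\lambda)_n\neq 0$. Then $$\frac{1}{x^n}=\frac{1}{a^n}\sum_{k=0}^n(-1)^k\lambda^{\binom{k}{2}}\genfrac{[}{]}{0pt}{}{n}{k}_{\lambda}(x-a)_\lambda^k.$$
   Context: $(x-a)_\lambda^0=1$ and $(x-a)_\lambda^k=\prod_{j=0}^{k-1}\left(1-\frac{a}{\lambda^j x}\right)$ for $k\ge 1$ (not an ordinary power). $(q;q)_0=1$, $(q;q)_m=\prod_{j=1}^m(1-q^j)$, and the $q$-binomial coefficient is $\genfrac{[}{]}{0pt}{}{n}{k}_{q}=\frac{(q;q)_n}{(q;q)_k(q;q)_{n-k}}$. *)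

(* Defs.v *)
From mathcomp Require Import all_boot all_order all_algebra.

Set Implicit Arguments.
Unset Strict Implicit.
Unset Printing Implicit Defensive.

Import GRing.Theory.
Local Open Scope ring_scope.

(* The q-Pochhammer symbol (q; q)_m. *)
Definition qfact (F : fieldType) (q : F) (m : nat) : F :=
  \prod_(1 <= j < m.+1) (1 - q ^+ j).

(* Meaningful only for k <= n (n - k is truncated) and (q; q)_n != 0. *)
Definition qbinom (F : fieldType) (q : F) (n k : nat) : F :=
  qfact q n / (qfact q k * qfact q (n - k)).

(* The shifted power (x - a)_lambda^k: neither an ordinary power nor a function
   of the difference x - a, hence the two separate arguments. *)
Definition qshift (F : fieldType) (lambda x a : F) (k : nat) : F :=
  \prod_(0 <= j < k) (1 - a / (lambda ^+ j * x)).

(* Main.v *)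
(** With t = a / x, the factor (-1)^k lambda^(k choose 2) turns the shifted power
    into P_k(t) = (t - 1) (t - lambda) ... (t - lambda^(k-1)), so the claim is
    Cauchy's expansion of t^n in the basis P_k. Since
    t P_k = P_(k+1) + lambda^k P_k, it follows from the q-Pascal rule by
    induction on n. *)
Require Import Defs.
From mathcomp Require Import all_boot all_order all_algebra.
From mathcomp Require Import complex.
From mathcomp Require Import reals.
From mathcomp Require Import ring.

Set Implicit Arguments.
Unset Strict Implicit.
Unset Printing Implicit Defensive.

Import GRing.Theory.
Local Open Scope ring_scope.
Local Open Scope complex_scope.

Lemma qfactS (F : fieldType) (q : F) (m : nat) :
  qfact q m.+1 = qfact q m * (1 - q ^+ m.+1).
Proof. by rewrite /qfact big_nat_recr. Qed.

(** The product for [m] is a factor of the one for [n], so non-vanishing at the top index alone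
    makes every q-binomial denominator invertible. *)
Lemma qfact_neq0_le (F : fieldType) (q : F) (m n : nat) :
  (m <= n)%N -> qfact q n != 0 -> qfact q m != 0.
Proof.
move=> /subnK <-; elim: (n - m)%N => [//|d IHd].
by rewrite addSn qfactS mulf_eq0 negb_or => /andP[/IHd].
Qed.

Lemma qbinom0 (F : fieldType) (q : F) (n : nat) :
  qfact q n != 0 -> qbinom q n 0 = 1.
Proof. by move=> hn; rewrite /qbinom subn0 {2}/qfact big_geq // mul1r divff. Qed.

Lemma qbinomn (F : fieldType) (q : F) (n : nat) :
  qfact q n != 0 -> qbinom q n n = 1.
Proof. by move=> hn; rewrite /qbinom subnn {3}/qfact big_geq // mulr1 divff. Qed.

(** Over the common denominator [qfact q k.+1 * qfact q (n - k)], this q-Pascal rule is 1 - q^(n+1)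
    = (1 - q^(k+1)) + q^(k+1) (1 - q^(n-k)). *)
Lemma qbinomS (F : fieldType) (q : F) (n k : nat) :
  (k < n)%N -> qfact q n != 0 ->
  qbinom q n.+1 k.+1 = qbinom q n k + q ^+ k.+1 * qbinom q n k.+1.
Proof.
move=> ltkn hn; rewrite /qbinom subSS.
have hk : qfact q k.+1 != 0 by exact: qfact_neq0_le hn.
have hm : qfact q (n - k) != 0 by exact: qfact_neq0_le (leq_subr _ _) hn.
have en : n.+1 = (k.+1 + (n - k))%N by rewrite addSn subnKC // ltnW.
rewrite qfactS [X in q ^+ X]en exprD.
(* Writing n - k as a successor lets [qfactS] split off its last factor. *)
rewrite -(subnSK ltkn) in hm *.
move: hk hm; rewrite !qfactS !mulf_eq0 !negb_or => /andP[h1 h2] /andP[h3 h4].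
by field; rewrite h1 h2 h3 h4.
Qed.

Lemma expr_qbinom (F : fieldType) (q t : F) (n : nat) :
  qfact q n != 0 ->
  t ^+ n = \sum_(0 <= k < n.+1) qbinom q n k * \prod_(0 <= j < k) (t - q ^+ j).
Proof.
elim: n => [|n IHn] hSn.
  by rewrite big_nat1 qbinom0 // big_geq // mulr1.
have hn : qfact q n != 0 by exact: qfact_neq0_le hSn.
pose P k := \prod_(0 <= j < k) (t - q ^+ j).
have tP k : t * P k = P k.+1 + q ^+ k * P k.
  by rewrite /P big_nat_recr //=; ring.
rewrite -[RHS]/(\sum_(0 <= k < n.+2) qbinom q n.+1 k * P k).
rewrite exprS (IHn hn) mulr_sumr.
under eq_bigr => k _ do rewrite mulrCA tP mulrDr.
(* Splitting off the top term of the [P k.+1] sum and the bottom term of the other aligns both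
   remainders on [P k.+1] with k < n, the range of [qbinomS]. The right side loses both its end
   terms to match. *)
rewrite big_split /= big_nat_recr //= [X in _ + X]big_nat_recl //=.
rewrite [RHS]big_nat_recl // [X in _ = _ + X]big_nat_recr //=.
rewrite !qbinom0 // !qbinomn // expr0 !mul1r.
under [X in _ = _ + (X + _)]eq_big_nat => k /andP[_ ltkn].
  rewrite qbinomS // mulrDl -mulrA [q ^+ _ * _]mulrCA; over.
by rewrite big_split /=; ring.
Qed.

(** Factor by factor, -q^j (1 - a / (q^j x)) = a / x - q^j, and the exponents 0, ..., k-1 add up to
    ['C(k, 2)]. *)
Lemma qshiftE (F : fieldType) (q x a : F) (k : nat) :
  q != 0 -> x != 0 ->
  (-1) ^+ k * q ^+ 'C(k, 2) * qshift q x a k =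
  \prod_(0 <= j < k) (a / x - q ^+ j).
Proof.
move=> hq hx; rewrite /qshift; elim: k => [|k IHk].
  by rewrite !big_geq // expr0 bin0n expr0 !mulr1.
rewrite !big_nat_recr //= -IHk binS bin1 exprD exprS.
by field; rewrite hx expf_neq0.
Qed.

Theorem theorem5 (R : realType) (n : nat) (a x lambda : R[i])
  (ha : a != 0) (hx : x != 0) (hlambda : lambda != 0)
  (hq : qfact lambda n != 0) :
  1 / x ^+ n =
  1 / a ^+ n *
    \sum_(0 <= k < n.+1)
      (-1) ^+ k * lambda ^+ 'C(k, 2) * qbinom lambda n k * qshift lambda x a k.
Proof.
under eq_bigr => k _ do rewrite mulrAC qshiftE // mulrC.
(* The sum is now the expansion of t^n at t = [a / x]. *)
rewrite -expr_qbinom // expr_div_n.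
by field; rewrite !expf_neq0.
Qed.
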